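(* Let $S$ be a Hausdorff topological semigroup whose square $S\times S$ is countably compact. Then $S$ is a topological paragroup if and only if $S$ is simple and contains an idempotent.
   Context: All topological spaces are Hausdorff and all semigroups are nonempty. A topological semigroup is a topological space with a jointly continuous associative binary operation. A semigroup $S$ is simple if it contains no proper (nonempty) two-sided ideal. A space is countably compact if each of its closed discrete subspaces is finite. For a group $H$, sets $X,Y$ and a map $\sigma:Y\times X\to H$, the Rees product $[X,H,Y]_\sigma$ is the set $X\times H\times Y$ with the operation $(x,h,y)\cdot(x',h',y')=(x,h\,\sigma(y,x')\,h',y')$. A topological paragroup is a topological semigroup that is topologically isomorphic (isomorphic via a homeomorphism) to a Rees product $[X,H,Y]_\sigma$ with the product topology, where $X,Y$ are topological spaces, $H$ is a topological group (multiplication and inversion continuous) and $\sigma:Y\times X\to H$ is continuous. *)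

(* Defs.v *)
(* MathComp / MathComp-Analysis *)
From HB Require Import structures.
From mathcomp Require Import all_boot all_order all_algebra.
From mathcomp Require Import all_classical all_reals topology.

Set Implicit Arguments.
Unset Strict Implicit.
Unset Printing Implicit Defensive.

Local Open Scope classical_set_scope.
Local Open Scope group_scope.

HB.mixin Record isTopologicalSemigroup S & Topological S & Semigroup S := {
  mulg_continuous : continuous (fun p : S * S => p.1 * p.2)
}.

#[short(type="topologicalSemigroupType")]
HB.structure Definition TopologicalSemigroup :=
  {S of Topological S & Semigroup S & isTopologicalSemigroup S}.

HB.mixin Record isTopologicalGroup G & Topological G & Group G := {
  invg_continuous : continuous (fun x : G => x^-1)
}.

#[short(type="topologicalGroupType")]
HB.structure Definition TopologicalGroup :=
  {G of TopologicalSemigroup G & Group G & isTopologicalGroup G}.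

Definition two_sided_ideal (S : semigroupType) (I : set S) : Prop :=
  I !=set0 /\ forall s x : S, I x -> I (s * x) /\ I (x * s).

Definition simple_semigroup (S : semigroupType) : Prop :=
  forall I : set S, two_sided_ideal I -> I = [set: S].

(* [set_type A] carries the subspace topology of [A]; the equation is the
   library's axiom for a discrete topology ([nbhs_principalE]). *)
Definition discrete_subspace (T : topologicalType) (A : set T) : Prop :=
  @nbhs (set_type A) (set_type A) = principal_filter.

Definition countably_compact (T : topologicalType) : Prop :=
  forall A : set T, closed A -> discrete_subspace A -> finite_set A.

Definition homeomorphism (T U : topologicalType) (f : T -> U) : Prop :=
  exists g : U -> T,
    [/\ cancel f g, cancel g f, continuous f & continuous g].

(* A plain operation rather than a semigroup instance: the canonical [*] on
   pairs is the componentwise one. *)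
Definition rees_mul (X Y : Type) (H : groupType) (sigma : Y * X -> H)
    (p q : X * H * Y) : X * H * Y :=
  let: (x, h, y) := p in
  let: (x', h', y') := q in
  (x, h * sigma (y, x') * h', y').

(* Spaces are Hausdorff by convention, hence so are X, H and Y. *)
Definition topological_paragroup (S : topologicalSemigroupType) : Prop :=
  exists (X Y : topologicalType) (H : topologicalGroupType)
         (sigma : Y * X -> H),
    [/\ hausdorff_space X, hausdorff_space Y, hausdorff_space H,
        continuous sigma &
        exists f : S -> X * H * Y,
          homeomorphism f /\ {morph f : p q / p * q >-> rees_mul sigma p q}].

(* Main.v *)
(* The nontrivial direction rests on the fact that every sequence in S * S has a
   cluster point. Let e be an idempotent of the simple semigroup S.
   - If p * q = e in the monoid e S e, a cluster point of (p^n, q^n) shows that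
     powers q^k with k > 0 come arbitrarily close to e; since q * p fixes all of
     them, q * p = e. With S = S s S this makes e S e a group.
   - Cluster points of pairs (y_n, y_n^-1), for suitable partial products y_n in
     the group e S e, show that its inversion is continuous.
   - Writing s = a e b gives s = s e t with t = (e b e)^-1 b, so s is recovered
     from its coordinates s e (e s e)^-1, e s e and (e s e)^-1 e s. *)
Require Import Defs.
From HB Require Import structures.
From mathcomp Require Import all_boot all_order all_algebra.
From mathcomp Require Import all_classical all_reals topology.

Local Open Scope classical_set_scope.
Local Open Scope group_scope.

Set Implicit Arguments.
Unset Strict Implicit.
Unset Printing Implicit Defensive.

(** * Separation, closures and cluster points of sequences *)

Lemma cluster_nbhs_image (U T : topologicalType) (f : U -> T) (p q : U) :
  hausdorff_space T -> continuous f -> cluster (nbhs p) q -> f p = f q.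
Proof.
move=> hT cf pq; apply: hT => A B /cf fA /cf fB.
by have [x [? ?]] := pq _ _ fA fB; exists (f x).
Qed.

Lemma hausdorff_inj (U T : topologicalType) (f : U -> T) :
  hausdorff_space T -> continuous f -> injective f -> hausdorff_space U.
Proof. by move=> hT cf inj_f p q pq; exact/inj_f/(cluster_nbhs_image hT). Qed.

Lemma fst_continuous (T U : topologicalType) : continuous (@fst T U).
Proof. by move=> p; exact: cvg_fst. Qed.

Lemma snd_continuous (T U : topologicalType) : continuous (@snd T U).
Proof. by move=> p; exact: cvg_snd. Qed.

Lemma pair_continuous (V T U : topologicalType) (f : V -> T) (g : V -> U) :
  continuous f -> continuous g -> continuous (fun x => (f x, g x)).
Proof. by move=> cf cg x; apply: cvg_pair; [exact: cf|exact: cg]. Qed.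

Lemma hausdorff_prod (T U : topologicalType) :
  hausdorff_space T -> hausdorff_space U -> hausdorff_space (T * U)%type.
Proof.
move=> hT hU p q pq; rewrite (surjective_pairing p) (surjective_pairing q).
rewrite (cluster_nbhs_image hT (@fst_continuous T U) pq).
by rewrite (cluster_nbhs_image hU (@snd_continuous T U) pq).
Qed.

Lemma closure_eq_fun (U T : topologicalType) (f g : U -> T) (A : set U) p :
  hausdorff_space T -> continuous f -> continuous g ->
  {in A, f =1 g} -> closure A p -> f p = g p.
Proof.
move=> hT cf cg fg clAp; apply: hT => V W fV gW.
have pVW : nbhs p (f @^-1` V `&` g @^-1` W).
  by apply: filterI; [exact: cf|exact: cg].
have [x [Ax [fVx gWx]]] := clAp _ pVW.
by exists (f x); split => //; rewrite fg ?inE.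
Qed.

(** Without a cluster point, every point has a neighbourhood that misses a tail of [u]. The range of
    [u] is then closed and discrete, hence finite, although each value is taken only finitely
    often. *)
Lemma countably_compact_cluster (T : topologicalType) (u : nat -> T) :
  countably_compact T -> accessible_space T -> exists p, cluster (u @ \oo) p.
Proof.
move=> ccT T1; apply: contrapT => /forallNP noacc.
have {}noacc (p : T) : exists B N, nbhs p B /\ forall n, (N <= n)%N -> ~ B (u n).
  apply: contrapT => /forallNP h; apply: (noacc p) => A B [N _ NA] pB.
  apply: contrapT => AB0; apply: (h B); exists N; split => // n Nn Bn.
  by apply: AB0; exists (u n); split => //; exact: NA.
pose A := range u.
have isolated (p : T) : nbhs p [set x | A x -> x = p].
  have [B [N [pB BN]]] := noacc p.
  (* Only the terms before [N] can lie in [B]; removing their finitely many values other than [p]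
     leaves a neighbourhood of [p]. *)
  pose F := (u @` `I_N) `\ p.
  have /accessible_finite_set_closed clT := T1.
  have clF : closed F by apply: clT; exact/finite_setD/finite_image/finite_II.
  have pF : nbhs p (~` F).
    apply: open_nbhs_nbhs; split; first exact: closed_openC.
    by move=> [_ /(_ erefl)].
  apply: filterS (filterI pB pF) => x [Bx Fx] [n _ unx].
  apply: contrapT => xp; apply: Fx; split => //; exists n => //=.
  by rewrite ltnNge; apply/negP => /BN; rewrite unx.
have clA : closed A.
  by move=> p /(_ _ (isolated p))[x [Ax /(_ Ax) <-]].
have dA : discrete_subspace A.
  apply/funext => x; apply/seteqP; split => U.
    by move=> /nbhs_singleton Ux; apply/principal_filterP.
  move=> /principal_filterP Ux.
  have xA : nbhs x ((set_val : A -> T) @^-1` [set y | A y -> y = set_val x]).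
    by apply: initial_continuous; exact: isolated.
  apply: filterS xA => y /= /(_ (set_mem (valP y))) yx.
  by rewrite (_ : y = x) //; exact: val_inj.
have /finite_seqP [s As] := ccT A clA dA.
have /choice [N NP] (p : T) : exists N, forall n, (N <= n)%N -> u n <> p.
  have [B [N [pB BN]]] := noacc p; exists N => n /BN Bn unp.
  by apply: Bn; rewrite unp; exact: nbhs_singleton.
(* The index [m] lies beyond the last occurrence of every value in the range, yet [u m] is such a
   value. *)
pose m := (\max_(p <- s) N p)%N.
have : A (u m) by exists m.
by rewrite As => /= um; apply: (NP (u m) m) => //; rewrite /m (leq_bigmax_seq _ um).
Qed.

Lemma cluster_frequently (T : topologicalType) (u : nat -> T) p B :
  cluster (u @ \oo) p -> nbhs p B ->
  forall N, exists2 n, (N <= n)%N & B (u n).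
Proof.
move=> up pB N; have [|_ [[n /= Nn <-] Bn]] := up (u @` [set n | (N <= n)%N]) B _ pB.
  by exists N => // n /= Nn; exists n.
by exists n.
Qed.

Lemma cluster_eq (T U : topologicalType) (f g : T -> U) (u : nat -> T) p :
  hausdorff_space U -> continuous f -> continuous g ->
  (forall n, f (u n) = g (u n)) -> cluster (u @ \oo) p -> f p = g p.
Proof.
move=> hU cf cg fg up; apply: (closure_eq_fun (A := range u) hU cf cg).
  by move=> x /[!inE] -[n _ <-].
move=> B pB; have [n _ Bn] := cluster_frequently up pB 0.
by exists (u n); split => //; exists n.
Qed.

(** * Products in topological semigroups and in simple semigroups *)

Lemma mulg_fun_continuous (U : topologicalType) (S : topologicalSemigroupType)
    (f g : U -> S) :
  continuous f -> continuous g -> continuous (fun x => f x * g x).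
Proof.
move=> cf cg x.
apply: continuous2_cvg; [|exact: cf|exact: cg].
exact: (@mulg_continuous S (f x, g x)).
Qed.

Lemma mulgl_continuous (S : topologicalSemigroupType) (c : S) :
  continuous (fun s => c * s).
Proof. by apply: mulg_fun_continuous => s; [exact: cvg_cst|exact: cvg_id]. Qed.

Lemma mulg_nbhs (S : topologicalSemigroupType) (a b : S) (W : set S) :
  nbhs (a * b) W ->
  exists A B, [/\ nbhs a A, nbhs b B & forall x y, A x -> B y -> W (x * y)].
Proof.
move=> /(@mulg_continuous S (a, b))[[A B] /= [aA bB] ABW].
by exists A, B; split => // x y Ax By; apply: (ABW (x, y)).
Qed.

(** The products [a * s * b] form a two-sided ideal, nonempty because it contains
    [s * s * s * s * s]. *)
Lemma simple_mul (S : semigroupType) (s x : S) : simple_semigroup S ->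
  exists a b, x = a * s * b.
Proof.
move=> simpleS; suff : two_sided_ideal [set x | exists a b, x = a * s * b].
  by move=> /simpleS/seteqP[_ /(_ x I)].
split=> [|c y [a [b ->]]]; first by exists (s * s * s), s, s.
split; first by exists (c * a), b; rewrite !mulgA.
by exists a, (b * c); rewrite !mulgA.
Qed.

(** Inversion in [e S e] is encoded as a total map on [S], with arbitrary values outside [e S e]. *)
Definition local_inverse (S : semigroupType) (e : S) (inv : S -> S) : Prop :=
  forall s, e * s * e = s ->
    [/\ e * inv s * e = inv s, inv s * s = e & s * inv s = e].

(** * Inverses in [e S e] and their continuity *)

Section LocalUnits.
Variables (S : topologicalSemigroupType) (e : S).
Hypothesis S_hausdorff : hausdorff_space S.
Hypothesis SS_cluster :
  forall w : nat -> S * S, exists p, cluster (w @ \oo) p.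

(** A cluster point of the pairs, rather than separate ones of [u] and [v], keeps the closed
    relation [u n * v n = e]. *)
Lemma cluster_mul (u v : nat -> S) : (forall n, u n * v n = e) ->
  exists a b : S, a * b = e /\ cluster ((fun n => (u n, v n)) @ \oo) (a, b).
Proof.
move=> uv; have [[a b] ab] := SS_cluster (fun n => (u n, v n)).
exists a, b; split => //.
by apply: (cluster_eq S_hausdorff (@mulg_continuous S) (@cst_continuous _ _ e)) ab.
Qed.

Lemma left_unit_right_unit (p q : S) :
  e * p = p -> p * e = p -> e * q = q -> q * e = q -> p * q = e -> q * p = e.
Proof.
move=> ep pe eq qe pq.
have ee : e * e = e by rewrite -{2}pq mulgA ep pq.
(* Powers in the monoid [e S e], with [e] as zeroth power. *)
pose pn n := iter n (fun s => p * s) e; pose qn n := iter n (fun s => s * q) e.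
have pqn n : pn n * qn n = e.
  elim: n => //= n IH.
  by rewrite -mulgA [pn n * _]mulgA IH mulgA pe.
have qnD m k : qn (m + k)%N = qn m * qn k.
  elim: k => [|k IH]; last by rewrite addnS /= IH mulgA.
  by rewrite addn0 /qn; case: m => [|m] /=; rewrite ?ee // -mulgA qe.
have eqn n : e * qn n = qn n by exact: (esym (qnD 0%N n)).
have qpqn k : q * p * qn k.+1 = qn k.+1.
  have -> : qn k.+1 = q * qn k by rewrite -(add1n k) qnD {1}/qn /= eq.
  by rewrite -mulgA [p * _]mulgA pq eqn.
have [a [b [ab cl_ab]]] := cluster_mul pqn.
(* The fixed points of left multiplication by [q * p] form a closed set, so it suffices to find them
   in every neighbourhood of [e]. *)
suff : q * p * e = e by rewrite -mulgA pe.
apply: (@closure_eq_fun _ _ (fun s => q * p * s) id [set s | q * p * s = s]) => //.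
- exact: mulgl_continuous.
- by move=> s; exact: cvg_id.
- by move=> s /set_mem.
move=> B eB; have /mulg_nbhs[A' [B' [aA bB AB]]] : nbhs (a * b) B by rewrite ab.
have abN : nbhs (a, b) (A' `*` B') by exists (A', B').
(* Two visits [m < n] to the same neighbourhood put [p^m * q^n = q^(n-m)] into [B]. The strict
   inequality makes the exponent positive, as [qpqn] requires. *)
have [m _ [Am _]] := cluster_frequently cl_ab abN 0.
have [n mn [_ Bn]] := cluster_frequently cl_ab abN m.+1.
exists (qn (n - m)%N); split.
  by rewrite -(prednK (n := (n - m)%N)) ?subn_gt0 //; exact: qpqn.
suff <- : pn m * qn n = qn (n - m)%N by apply: AB.
by rewrite -{1}(subnKC (ltnW mn)) qnD mulgA pqn eqn.
Qed.

(** Simplicity gives [a' * s * b' = e] with [a'] and [b'] in [e S e]. Swapping the factors of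
    [(a' * s) * b'] and of [a' * (s * b')] shows that [b' * a'] is inverse to [s] on both sides. *)
Lemma simple_local_inverse (s : S) : simple_semigroup S ->
  e * e = e -> e * s * e = s ->
  exists t, [/\ e * t * e = t, t * s = e & s * t = e].
Proof.
move=> simpleS ee ese.
have es : e * s = s by rewrite -ese !mulgA ee.
have se : s * e = s by rewrite -ese -!mulgA ee.
have [a [b eE]] := simple_mul s e simpleS.
pose a' := e * a * e; pose b' := e * b * e.
have ea : e * a' = a' by rewrite /a' !mulgA ee.
have ae : a' * e = a' by rewrite /a' -!mulgA ee.
have eb : e * b' = b' by rewrite /b' !mulgA ee.
have be : b' * e = b' by rewrite /b' -!mulgA ee.
have asb : a' * s * b' = e.
  rewrite /a' /b' !mulgA -[e * a * e * s]mulgA es -[_ * s * e]mulgA se.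
  by rewrite -[e * a * s]mulgA -mulgA -[_ * (b * e)]mulgA [(a * s) * _]mulgA -eE !ee.
clearbody a' b'; exists (b' * a'); split.
- by rewrite mulgA eb -mulgA ae.
- rewrite -mulgA; apply: left_unit_right_unit; rewrite ?mulgA ?ea //.
  by rewrite -mulgA se.
- rewrite mulgA; apply: left_unit_right_unit; rewrite ?mulgA ?es //.
  by rewrite -mulgA be.
Qed.

Variable inv : S -> S.
Hypothesis ee : e * e = e.
Hypothesis invP : local_inverse e inv.

Let H : set S := [set s | e * s * e = s].

Let He : H e. Proof. by rewrite /H /= !ee. Qed.
Let Hl s : H s -> e * s = s. Proof. by move=> <-; rewrite !mulgA ee. Qed.
Let Hr s : H s -> s * e = s. Proof. by move=> <-; rewrite -!mulgA ee. Qed.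
Let HM s t : H s -> H t -> H (s * t).
Proof. by move=> Hs Ht; rewrite /H /= mulgA Hl // -mulgA Hr. Qed.
Let HV s : H s -> H (inv s). Proof. by move=> /invP[]. Qed.
Let HVl s : H s -> inv s * s = e. Proof. by move=> /invP[]. Qed.
Let HVr s : H s -> s * inv s = e. Proof. by move=> /invP[]. Qed.

Let inv_unique s t : H s -> H t -> t * s = e -> inv s = t.
Proof.
by move=> Hs Ht ts; rewrite -(Hl (HV Hs)) -ts -mulgA HVr // Hr.
Qed.

(** The condition on [U] stands under the existential, so that [choice] gives a map on all sets,
    which can be iterated. *)
Let nbhs_sqrt (U : set S) : exists V : set S,
  nbhs e U -> nbhs e V /\ forall x y, V x -> V y -> U (x * y).
Proof.
have [eU|] := pselect (nbhs e U); last by exists setT.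
have /mulg_nbhs[A [B [eA eB AB]]] : nbhs (e * e) U by rewrite ee.
exists (A `&` B) => _; split; first exact: filterI.
by move=> x y [Ax _] [_ By]; exact: AB.
Qed.

(* If [x_n] tends to [e] fast while [x_n^-1] stays away from [e], then the
   partial products [y_n = x_0 ... x_(n-1)] and their inverses cluster together,
   so that [y_m^-1 * y_n] is near [e] for some [n < m]; but [x_n^-1] is the
   product of [x_(n+1) ... x_(m-1)] and [y_m^-1 * y_n]. *)
Lemma inv_near_unit (U : set S) :
  nbhs e U -> nbhs e [set s | H s -> U (inv s)].
Proof.
move=> eU; apply: contrapT => nU.
have [root rootP] := choice nbhs_sqrt.
pose V n := iter n root U.
have eV n : nbhs e (V n) by elim: n => //= n IH; have [] := rootP _ IH.
have VM n x y : V n.+1 x -> V n.+1 y -> V n (x * y).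
  by have [_] := rootP _ (eV n); apply.
(* On [e S e] the sets [V n] decrease, since [x = x * e] and [e] lies in each of them. *)
have V1 n x : H x -> V n.+1 x -> V 1%N x.
  move=> Hx; elim: n => // n IH Vx; apply: IH.
  by rewrite -(Hr Hx); apply: VM => //; exact: nbhs_singleton.
have /choice[x xP] (n : nat) : exists s : S, [/\ H s, V n.+1 s & ~ U (inv s)].
  apply: contrapT => /forallNP h; apply: nU.
  apply: filterS (eV n.+1) => s Vs Hs; apply: contrapT => nUs.
  by apply: (h s).
have Hx n : H (x n) by have [] := xP n.
pose y := fix y n := if n is m.+1 then y m * x m else e.
have Hy n : H (y n) by elim: n => //= n IH; apply: HM.
(* The block [w k j] is the product of [x j] up to [x (j + k - 1)]. Its first factor and its
   remaining block both lie in [V j.+1], so the block lies in [V j] whatever its length. *)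
pose w := fix w k j := if k is l.+1 then x j * w l j.+1 else e.
have Vw k j : V j (w k j).
  elim: k j => [|k IH] j /=; first exact: nbhs_singleton.
  by apply: VM; [have [] := xP j | exact: IH].
have Hw k j : H (w k j) by elim: k j => //= k IH j; apply: HM.
have yD k j : y (k + j)%N = y j * w k j.
  elim: k j => [|k IH] j; first by rewrite /= Hr.
  by rewrite addSnnS IH /= mulgA.
have [a [b [ab cl_ab]]] := cluster_mul (fun n => HVr (Hy n)).
have ba : b * a = e.
  apply: (@cluster_eq _ _ (fun p => p.2 * p.1) (fun=> e) _ (a, b)) cl_ab => //.
  - apply: mulg_fun_continuous; [exact: snd_continuous|exact: fst_continuous].
  - by move=> ?; exact: cvg_cst.
  - by move=> n /=; exact: HVl.
have /mulg_nbhs[B [A [bB aA AB]]] : nbhs (b * a) (V 1%N) by rewrite ba.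
have abN : nbhs (a, b) (A `*` B) by exists (A, B).
have [n _ [An _]] := cluster_frequently cl_ab abN 0.
have [m mn [_ Bm]] := cluster_frequently cl_ab abN n.+1.
have [_ _] := xP n; apply.
pose k := (m - n.+1)%N.
have ym : y m = y n * x n * w k n.+1 by rewrite -(subnK mn) yD.
suff -> : inv (x n) = w k n.+1 * (inv (y m) * y n).
  by apply: (VM 0%N); [exact: V1 (Hw _ _) (Vw _ _) | exact: AB].
apply: inv_unique => //; first by do !apply: HM => //; exact: HV.
(* With [w] for [w k n.+1], appending [e = w * inv w] on the right completes [y n * x n * w = y m],
   which cancels against [inv (y m)]. *)
rewrite -!mulgA -[X in _ * X]Hr; last by do !apply: HM => //; exact: HV.
rewrite -(HVr (Hw k n.+1)) !mulgA -[_ * y n * x n]mulgA -[_ * w k n.+1]mulgA.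
by rewrite -ym -[_ * y m]mulgA HVl // Hr.
Qed.

(** Translation by [h], the inverse of [e * a * e], reduces continuity at [a] to the unit: [inv (e *
    s * e) = inv (h * (e * s * e)) * h], where the first factor is near [e] for [s] near [a]. *)
Lemma inv_continuous : continuous (fun s => inv (e * s * e)).
Proof.
have ce : continuous (fun s => e * s * e).
  by apply: mulg_fun_continuous; [exact: mulgl_continuous|move=> ?; exact: cvg_cst].
have HeE s : H (e * s * e) by rewrite /H /= !mulgA ee -!mulgA ee.
move=> a W; set h := inv (e * a * e) => hW.
have Hh : H h by exact: HV.
have /mulg_nbhs[A [B [eA hB ABW]]] : nbhs (e * h) W by rewrite Hl.
have ch : continuous (fun s => h * (e * s * e)).
  by apply: mulg_fun_continuous ce => ?; exact: cvg_cst.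
have aA : nbhs a ((fun s => h * (e * s * e)) @^-1` [set s | H s -> A (inv s)]).
  by apply: ch; rewrite /h HVl //; exact: inv_near_unit.
apply: filterS aA => s /= /(_ (HM Hh (HeE s))) Ahs.
have -> : inv (e * s * e) = inv (h * (e * s * e)) * h.
  apply: inv_unique => //; first by apply: HM => //; apply/HV/HM.
  by rewrite -mulgA HVl //; exact: HM.
by apply: ABW; [exact: Ahs|exact: nbhs_singleton].
Qed.

End LocalUnits.

(** * The topological group [e S e] and the Rees coordinates *)

Lemma continuous_set_type (U T : topologicalType) (A : set T)
    (f : U -> set_type A) :
  continuous (set_val \o f) -> continuous f.
Proof. exact: (@continuous_comp_initial (set_type A) U T set_val f). Qed.

Lemma set_type_hausdorff (T : topologicalType) (A : set T) :
  hausdorff_space T -> hausdorff_space (set_type A).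
Proof.
move=> hT; apply: (hausdorff_inj hT (@initial_continuous _ _ set_val)).
exact: val_inj.
Qed.

Section ReesCoordinates.
Variables (S : topologicalSemigroupType) (e : S) (inv : S -> S).

(* The phantom arguments let the group instances depend on the hypotheses. *)
Definition local_group (_ : e * e = e) (_ : local_inverse e inv)
  (_ : continuous (fun s => inv (e * s * e))) : Type :=
  set_type [set s | e * s * e = s].

Hypotheses (ee : e * e = e) (invP : local_inverse e inv)
  (inv_cont : continuous (fun s => inv (e * s * e))).

Local Notation G := (local_group ee invP inv_cont).

HB.instance Definition _ := Topological.copy G (set_type [set s | e * s * e = s]).

Definition lval (h : G) : S := set_val h.

Lemma lval_inj : injective lval. Proof. exact: val_inj. Qed.

Lemma lval_continuous : continuous lval.
Proof. exact: initial_continuous. Qed.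

Lemma lvalP (h : G) : e * lval h * e = lval h.
Proof. exact/set_mem/(valP h). Qed.

Lemma mulelval (h : G) : e * lval h = lval h.
Proof. by rewrite -lvalP !mulgA ee. Qed.

Lemma mullvale (h : G) : lval h * e = lval h.
Proof. by rewrite -lvalP -!mulgA ee. Qed.

(** This retraction onto [e S e] carries the membership proof for all the group operations; it is
    transparent, so that its value computes. *)
Definition corner (s : S) : G.
Proof. by exists (e * s * e); apply/mem_set; rewrite /= !mulgA ee -!mulgA ee. Defined.

Lemma lval_corner s : lval (corner s) = e * s * e. Proof. by []. Qed.

Let one : G := corner e.
Let mul (h k : G) : G := corner (lval h * lval k).
Let invG (h : G) : G := corner (inv (lval h)).

Let lval_mul h k : lval (mul h k) = lval h * lval k.
Proof. by rewrite lval_corner mulgA mulelval -mulgA mullvale. Qed.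
Let lval_one : lval one = e. Proof. by rewrite lval_corner !ee. Qed.
Let lval_inv h : lval (invG h) = inv (lval h).
Proof. by rewrite lval_corner; have [] := invP (lvalP h). Qed.

Let mulA : associative mul.
Proof. by move=> h k l; apply: lval_inj; rewrite !lval_mul mulgA. Qed.
Let mul1 : left_id one mul.
Proof. by move=> h; apply: lval_inj; rewrite lval_mul lval_one mulelval. Qed.
Let mulr1 : right_id one mul.
Proof. by move=> h; apply: lval_inj; rewrite lval_mul lval_one mullvale. Qed.
Let mulV : left_inverse one invG mul.
Proof.
move=> h; apply: lval_inj; rewrite lval_mul lval_one lval_inv.
by have [] := invP (lvalP h).
Qed.
Let mulrV : right_inverse one invG mul.
Proof.
move=> h; apply: lval_inj; rewrite lval_mul lval_one lval_inv.
by have [] := invP (lvalP h).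
Qed.

HB.instance Definition _ := isGroup.Build G mulA mul1 mulr1 mulV mulrV.

Lemma lvalM (h k : G) : lval (h * k) = lval h * lval k.
Proof. exact: lval_mul. Qed.
Lemma lvalV (h : G) : lval h^-1 = inv (lval h). Proof. exact: lval_inv. Qed.

Lemma local_group_mul_continuous : continuous (fun p : G * G => p.1 * p.2).
Proof.
apply: continuous_set_type.
rewrite (_ : _ \o _ = fun p : G * G => lval p.1 * lval p.2).
  apply: mulg_fun_continuous => p; apply: continuous_comp.
  - exact: fst_continuous.
  - exact: lval_continuous.
  - exact: snd_continuous.
  - exact: lval_continuous.
by apply/funext => p; rewrite -lvalM.
Qed.
HB.instance Definition _ :=
  isTopologicalSemigroup.Build G local_group_mul_continuous.

Lemma local_group_inv_continuous : continuous (fun h : G => h^-1).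
Proof.
apply: continuous_set_type.
rewrite (_ : _ \o _ = (fun s => inv (e * s * e)) \o lval).
  by move=> h; apply: continuous_comp; [exact: lval_continuous|exact: inv_cont].
by apply/funext => h; rewrite /= lvalP -lvalV.
Qed.
HB.instance Definition _ := isTopologicalGroup.Build G local_group_inv_continuous.

(* When [e S e] is a group these are the idempotents of [S e] and of [e S]. *)
Definition right_unit_set : set S := [set x | x * e = x /\ e * x = e].
Definition left_unit_set : set S := [set y | e * y = y /\ y * e = e].

Local Notation X := (set_type right_unit_set).
Local Notation Y := (set_type left_unit_set).

Let ix s := inv (e * s * e).

Let ixP s : [/\ e * ix s = ix s, ix s * e = ix s,
  ix s * s * e = e & e * s * ix s = e].
Proof.
have [|ixe ixs sx] := invP (s := e * s * e).
  by rewrite !mulgA ee -!mulgA ee.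
have eix : e * ix s = ix s by rewrite /ix -[in LHS]ixe !mulgA ee ixe.
have ixE : ix s * e = ix s by rewrite /ix -[in LHS]ixe -mulgA ee ixe.
split=> //; first by rewrite -[RHS]ixs -/(ix s) !mulgA ixE.
by rewrite -[RHS]sx -/(ix s) -[RHS]mulgA eix.
Qed.

Definition rees_x (s : S) : X.
Proof.
exists (s * ix s); apply/mem_set; have [_ ixe _ sx] := ixP s.
by split; rewrite ?mulgA // -mulgA ixe.
Defined.

Definition rees_y (s : S) : Y.
Proof.
exists (ix s * s); apply/mem_set; have [eix _ xs _] := ixP s.
by split; rewrite ?mulgA ?eix.
Defined.

Definition rees_sigma (p : Y * X) : G := corner (set_val p.1 * set_val p.2).

Definition rees_coord (s : S) : X * G * Y := (rees_x s, corner s, rees_y s).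

Definition rees_prod (p : X * G * Y) : S :=
  set_val p.1.1 * lval p.1.2 * set_val p.2.

Let XP (x : X) : set_val x * e = set_val x /\ e * set_val x = e.
Proof. exact/set_mem/(valP x). Qed.

Let YP (y : Y) : e * set_val y = set_val y /\ set_val y * e = e.
Proof. exact/set_mem/(valP y). Qed.

Lemma rees_prodM : {morph rees_prod : p q / rees_mul rees_sigma p q >-> p * q}.
Proof.
move=> [[x h] y] [[x' h'] y']; rewrite /rees_prod /= !lvalM lval_corner /=.
have [ey _] := YP y; have [xe _] := XP x'.
by rewrite !mulgA -(mulgA _ e (set_val y)) ey -(mulgA _ (set_val x') e) xe.
Qed.

(** For [s = x * h * y], the relations [e * x = e] and [y * e = e] give [e * s * e = h],
    [s * e = x * h] and [e * s = h * y]; cancelling [h] recovers [x] and [y]. *)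
Lemma rees_prodK : cancel rees_prod rees_coord.
Proof.
move=> [[x h] y]; rewrite /rees_coord /rees_prod /=.
set s := _ * _ * _.
have [xe ex] := XP x; have [ey ye] := YP y.
have se : s * e = set_val x * lval h by rewrite /s -!mulgA ye mullvale.
have es : e * s = lval h * set_val y by rewrite /s !mulgA ex mulelval.
have ese : e * s * e = lval h by rewrite es -mulgA ye mullvale.
have [_ hx xh] := invP (lvalP h); have [eix ixe _ _] := ixP s.
have ixE : ix s = inv (lval h) by rewrite /ix ese.
congr (_, _, _); apply: val_inj; rewrite /=.
- by rewrite -/(ix s) -eix mulgA se -mulgA ixE xh xe.
- exact: ese.
- by rewrite -/(ix s) -ixe -mulgA es mulgA ixE hx ey.
Qed.

(** The product of the coordinates reduces to [s * ix s * s]. Left multiplication by [s * ix s]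
    fixes [s * e], hence also [s = s * e * t]. *)
Lemma rees_coordK : (forall s, exists t, s = s * e * t) -> cancel rees_coord rees_prod.
Proof.
move=> sR s; rewrite /rees_prod /= lval_corner.
have [eix ixe xs sx] := ixP s; have [t st] := sR s.
rewrite -/(ix s) -[in LHS](mulgA s) !mulgA -(mulgA s _ e) ixe.
have sixse : s * ix s * s * e = s * e by rewrite -[in RHS]xs !mulgA.
by rewrite sixse -(mulgA s e) eix {3}st !mulgA sixse -st.
Qed.

Lemma rees_coord_homeomorphism :
  (forall s, exists t, s = s * e * t) -> homeomorphism rees_coord.
Proof.
move=> sR; exists rees_prod; split.
- exact: rees_coordK.
- exact: rees_prodK.
- have cid : continuous (fun s : S => s) by move=> s; exact: cvg_id.
  apply: pair_continuous; first apply: pair_continuous.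
  + by apply: continuous_set_type; exact: mulg_fun_continuous.
  + apply: continuous_set_type; apply: mulg_fun_continuous.
      exact: mulgl_continuous.
    by move=> s; exact: cvg_cst.
  + by apply: continuous_set_type; exact: mulg_fun_continuous.
- apply: mulg_fun_continuous; first apply: mulg_fun_continuous.
  + move=> p; apply: (continuous_comp (f := fst \o fst)).
      by apply: continuous_comp; exact: fst_continuous.
    exact: initial_continuous.
  + move=> p; apply: (continuous_comp (f := snd \o fst)).
      by apply: continuous_comp; [exact: fst_continuous|exact: snd_continuous].
    exact: lval_continuous.
  + move=> p; apply: continuous_comp; first exact: snd_continuous.
    exact: initial_continuous.
Qed.

Lemma rees_sigma_continuous : continuous rees_sigma.
Proof.
apply: continuous_set_type; apply: mulg_fun_continuous; last first.
  by move=> p; exact: cvg_cst.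
apply: mulg_fun_continuous; first by move=> p; exact: cvg_cst.
apply: mulg_fun_continuous => p; apply: continuous_comp.
- exact: fst_continuous.
- exact: initial_continuous.
- exact: snd_continuous.
- exact: initial_continuous.
Qed.

Lemma topological_paragroup_local_group : hausdorff_space S ->
  (forall s, exists t, s = s * e * t) -> topological_paragroup S.
Proof.
move=> hS sR; exists X, Y, G, rees_sigma; split.
- exact: set_type_hausdorff.
- exact: set_type_hausdorff.
- exact: set_type_hausdorff.
- exact: rees_sigma_continuous.
exists rees_coord; split; first exact: rees_coord_homeomorphism.
move=> p q; rewrite -[in LHS](rees_coordK sR p) -[in LHS](rees_coordK sR q).
by rewrite -rees_prodM rees_prodK.
Qed.

End ReesCoordinates.

(** * Simplicity and idempotents of Rees products *)

Section ReesSimple.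
Variables (S : semigroupType) (X Y : Type) (H : groupType) (sigma : Y * X -> H).
Variables (f : S -> X * H * Y) (g : X * H * Y -> S).
Hypotheses (fK : cancel f g) (gK : cancel g f).
Hypothesis fM : {morph f : p q / p * q >-> rees_mul sigma p q}.

Lemma rees_simple : simple_semigroup S.
Proof.
move=> I [[a Ia] idI]; apply/seteqP; split=> // s _.
case fa : (f a) => [[x h] y]; case fs : (f s) => [[x' h'] y'].
(* The inner coordinates [y] of [p] and [x] of [q] produce [sigma (y, x)] on both sides of [h]; the
   middle entry of [p] cancels the result and leaves [h']. *)
pose p := g (x', h' * (sigma (y, x) * h * sigma (y, x))^-1, y).
pose q := g (x, 1, y').
suff -> : s = p * a * q by apply: (idI _ _ (idI _ _ Ia).1).2.
apply: (can_inj fK); rewrite !fM /p /q !gK fa fs /=.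
by rewrite mulg1 -!mulgA mulVg mulg1.
Qed.

Lemma rees_idempotent : [set: S] !=set0 -> exists e : S, e * e = e.
Proof.
move=> [s _]; case: (f s) => [[x _] y]; exists (g (x, (sigma (y, x))^-1, y)).
by apply: (can_inj fK); rewrite fM !gK /= mulVg mul1g.
Qed.

End ReesSimple.

Unset Implicit Arguments.

Theorem theorem10 (S : topologicalSemigroupType)
    (S_nonempty : [set: S] !=set0)
    (S_hausdorff : hausdorff_space S)
    (SS_countably_compact : countably_compact (S * S)%type) :
  topological_paragroup S <->
  (simple_semigroup S /\ exists e : S, e * e = e).
Proof.
split.
  move=> [X [Y [H [sigma [_ _ _ _ [f [[g [fK gK _ _]] fM]]]]]]].
  by split; [exact: rees_simple fK gK fM|exact: rees_idempotent fK gK fM S_nonempty].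
move=> [simpleS [e ee]].
have SS_cluster w : exists p : S * S, cluster (w @ \oo) p.
  apply: countably_compact_cluster SS_countably_compact _.
  exact/hausdorff_accessible/hausdorff_prod.
have /choice[inv invP] s : exists t, e * s * e = s ->
    [/\ e * t * e = t, t * s = e & s * t = e].
  (* Outside [e S e] the value [s] is a dummy. *)
  have [ese|] := pselect (e * s * e = s); last by exists s.
  have [t tP] := simple_local_inverse S_hausdorff SS_cluster simpleS ee ese.
  by exists t.
have inv_cont := inv_continuous S_hausdorff SS_cluster ee invP.
apply: (topological_paragroup_local_group ee invP inv_cont S_hausdorff) => s.
have [a [b sE]] := simple_mul e s simpleS.
have ebe : e * (e * b * e) * e = e * b * e by rewrite !mulgA ee -!mulgA ee.
have [_ _ bV] := invP _ ebe.
exists (inv (e * b * e) * b).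
have aebe : a * (e * b * e * inv (e * b * e)) * b = s by rewrite bV.
by rewrite {2}sE -[LHS]aebe !mulgA.
Qed.
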